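(* Let $G$ be a finite abelian group, $S$ a symmetric multiset of elements of $G$ with $k$ elements (counted with multiplicity), and $F$ a function assigning to each element $s$ of $S$ an invertible complex $N\times N$ matrix $F(s)$ such that $F(s^{-1})=F(s)^\star$. Let $(X,G;S)$ be the Cayley graph with transmission system $P(x,y,s)=F(s)=F(x^{-1}y)$. Then the eigenvalues (with multiplicity) of the transmission graph Laplacian $\Delta^P$ of this $k$-regular graph are exactly the numbers $1-\frac1k\lambda(\chi,F)$, where $\chi$ ranges over the irreducible characters of $G$ and $\lambda(\chi,F)$ ranges over the $N$ eigenvalues of the matrix $\sum_{s\in S}\chi(s)F(s)$ (sum with multiplicity).
   Context: A multiset $S\subset G$ is symmetric if $s\in S$ implies $s^{-1}\in S$ with the same multiplicity. The Cayley graph $(X,G;S)$ has vertex set $G$ and, for each $x,y\in G$, one directed edge $(x,y,s)$ from $x$ to $y$ for each occurrence of $s=x^{-1}y$ in $S$; the opposite of $(x,y,s)$ is $(y,x,s^{-1})$. The degree of a vertex $w$ is the number of directed edges with terminal point $w$ (here $k$ for all $w$). Transmission graph Laplacian: on cochains $f:G\to\mathbb{C}^N$, $(\Delta^P f)(w)=f(w)-\sum_{\vec e:\ t(\vec e)=w}\frac{1}{\sqrt{d_w d_{i(\vec e)}}}P(\vec e)f(i(\vec e))$, where $i(\vec e),t(\vec e)$ denote the initial and terminal points of $\vec e$ and $d_v$ the degree; here this is $f(w)-\frac1k\sum_{\vec e: t(\vec e)=w}P(\vec e)f(i(\vec e))$. *)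

(* Defs.v *)
From HB Require Import structures.
From mathcomp Require Import all_boot all_order all_algebra.
From mathcomp Require Import all_fingroup mxrepresentation.
From mathcomp Require Import spectral.
From mathcomp Require Import finmap multiset reals.
From mathcomp Require Export complex.

Set Implicit Arguments.
Unset Strict Implicit.
Unset Printing Implicit Defensive.

Import Order.TTheory GRing.Theory Num.Theory.
Local Open Scope mset_scope.
Local Open Scope sesquilinear_scope.
Local Open Scope ring_scope.

Definition eigenvalues (C : closedFieldType) n (A : 'M[C]_n) : seq C :=
  sval (closed_field_poly_normal (char_poly A)).

Lemma char_poly_eigenvalues (C : closedFieldType) n (A : 'M[C]_n) :
  char_poly A = \prod_(z <- eigenvalues A) ('X - z%:P).
Proof.
rewrite /eigenvalues; case: closed_field_poly_normal => /= r {1}->.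
by rewrite (monicP (char_poly_monic A)) scale1r.
Qed.

(* The characteristic polynomial of the matrix of [f] does not depend on the
   chosen basis. *)
Definition lfun_eigenvalues (C : closedFieldType) (V : vectType C)
    (f : 'End(V)) : seq C :=
  eigenvalues (passmx.mxof (vbasis fullv) (vbasis fullv) f).

(* The library's 'chi_i take values in [algC]; characters with values in [C]
   are obtained as traces of the irreducible representations over [C], indexed
   by their isomorphism classes. *)
Definition irr_index (C : closedFieldType) (gT : finGroupType) :
    irrType C [set: gT] :=
  DecSocleType (regular_repr C [set: gT]).

Definition irr_char (C : closedFieldType) (gT : finGroupType)
    (i : irr_index C gT) (g : gT) : C := \tr (irr_repr i g).

Record graph := Graph {
  vertex : finType;
  edge : finType;
  initial : edge -> vertex;
  terminal : edge -> vertex;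
  opposite : edge -> edge;
  oppositeK : involutive opposite;
  initial_opposite : forall e, initial (opposite e) = terminal e }.

Definition degree (X : graph) (w : vertex X) : nat :=
  #|[set e : edge X | terminal e == w]|.

Section Laplacian.
Variables (C : numClosedFieldType) (X : graph) (N : nat).
Variable P : edge X -> 'M[C]_N.

Definition laplacian (f : {ffun vertex X -> 'cV[C]_N}) :
    {ffun vertex X -> 'cV[C]_N} :=
  [ffun w => f w - \sum_(e : edge X | terminal e == w)
     (sqrtC ((degree w)%:R * (degree (initial e))%:R))^-1 *:
       (P e *m f (initial e))].

Fact laplacian_is_linear : linear laplacian.
Proof.
move=> a f g; apply/ffunP => w; rewrite !ffunE scalerBr scaler_sumr.
rewrite addrACA -opprD -big_split /=; congr (_ - _).
apply: eq_bigr => e _; rewrite !ffunE mulmxDr -scalemxAr scalerDr.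
by rewrite !scalerA mulrC.
Qed.

HB.instance Definition _ :=
  GRing.isLinear.Build C {ffun vertex X -> 'cV[C]_N}
    {ffun vertex X -> 'cV[C]_N} _ laplacian laplacian_is_linear.
End Laplacian.

Definition msymmetric (gT : finGroupType) (S : {mset gT}) : Prop :=
  forall s : gT, S (s^-1)%g = S s.

Section Cayley.
Variables (gT : finGroupType) (S : {mset gT}) (hS : msymmetric S).

Definition cayley_label (p : gT * gT) : gT := (p.1^-1 * p.2)%g.

(* An edge [(x, y, s)] is a pair of vertices [(x, y)], which determines
   [s = x^-1 y], together with the number of an occurrence of [s] in [S]. *)
Definition cayley_edge : finType := {p : gT * gT & 'I_(S (cayley_label p))}.

Fact cayley_label_swap p : S (cayley_label p) = S (cayley_label (p.2, p.1)).
Proof. by rewrite /cayley_label -[LHS]hS invMg invgK. Qed.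

Definition cayley_opposite (e : cayley_edge) : cayley_edge :=
  existT (fun p => 'I_(S (cayley_label p)))
    ((tag e).2, (tag e).1) (cast_ord (cayley_label_swap (tag e)) (tagged e)).

Fact cayley_oppositeK : involutive cayley_opposite.
Proof.
case=> [[x y] j]; rewrite /cayley_opposite /=.
by congr (existT _ _ _); apply: val_inj.
Qed.

Definition cayley : graph :=
  @Graph gT cayley_edge (fun e => (tag e).1) (fun e => (tag e).2)
    cayley_opposite cayley_oppositeK (fun=> erefl).

Lemma cayley_degree (w : vertex cayley) : degree w = size S.
Proof.
rewrite /degree -sum1_card.
under eq_bigl do rewrite inE.
have -> : (\sum_(e : cayley_edge | (tag e).2 == w) 1 =
    \sum_(p : gT * gT | p.2 == w) S (cayley_label p))%N.
  under [RHS]eq_bigr => p _ do rewrite -[S _]card_ord -sum1_card.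
  rewrite sig_big_dep; apply: eq_big => [[p j]|[p j] _] //=.
  by rewrite inE andbT.
rewrite (reindex_onto (fun x : gT => (w * x^-1, w)%g)
                      (fun p => (p.1^-1 * w)%g)) /=; last first.
  by case=> x y /= /eqP ->; rewrite invMg invgK mulKVg.
rewrite size_mset big_uniq /=; last exact: fset_uniq.
rewrite [RHS]big_mkcond /=; apply: eq_big => [x|x _].
  by rewrite eqxx invMg invgK mulgKV eqxx.
rewrite /cayley_label /= invMg invgK mulgKV.
by case: ifPn => // /fsfun_dflt ->.
Qed.

Definition cayley_transmission (C : Type) N (F : gT -> 'M[C]_N)
    (e : edge cayley) : 'M[C]_N := F (cayley_label (tag e)).
End Cayley.
Arguments cayley_transmission {gT S} hS {C N} F e.

(* Main.v *)
(* For a character chi of the abelian group, the functions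
   w |-> chi (w^-1) v, with v a column vector, form a copy of C^N on which the
   Laplacian acts as the matrix 1 - k^-1 sum_s chi(s) F(s).  The irreducible
   characters are linearly independent and there are #|G| of them, so these
   copies decompose the space of cochains and the characteristic polynomial
   factors accordingly.  The inverse in chi (w^-1) makes chi(s), and not its
   conjugate, appear in the sum: the edge labelled s ending at w starts at
   w s^-1. *)

From HB Require Import structures.
Require Import Defs.
From mathcomp Require Import all_boot all_order all_algebra.
From mathcomp Require Import all_fingroup all_solvable mxrepresentation.
From mathcomp Require Import spectral.
From mathcomp Require Import finmap multiset reals complex.

Set Implicit Arguments.
Unset Strict Implicit.
Unset Printing Implicit Defensive.

Import Order.TTheory GRing.Theory Num.Theory passmx.
Local Open Scope mset_scope.
Local Open Scope sesquilinear_scope.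
Local Open Scope ring_scope.

Lemma char_poly_castmx (R : comNzRingType) m n (eq_mn : m = n) (A : 'M[R]_m) :
  char_poly (castmx (eq_mn, eq_mn) A) = char_poly A.
Proof. by case: n / eq_mn; rewrite castmx_id. Qed.

Lemma char_poly_tr (R : comNzRingType) n (A : 'M[R]_n) :
  char_poly A^T = char_poly A.
Proof.
by rewrite /char_poly /char_poly_mx -[in RHS]det_tr linearB /= tr_scalar_mx
  map_trmx.
Qed.

Lemma char_poly_mxdiag (R : comNzRingType) m (p : 'I_m -> nat)
    (A : forall i, 'M[R]_(p i)) :
  char_poly (\mxdiag_i A i) = \prod_i char_poly (A i).
Proof.
elim: m p A => [|m IHm] p A.
  (* The size is an empty sum, so the matrix is generalised before that sum is rewritten to [0]. *)
  rewrite [RHS]big_ord0; move: (\mxdiag_i A i); rewrite big_ord0 => B.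
  exact: det_mx00.
rewrite mxdiag_recl char_poly_castmx big_ord_recl -IHm.
by rewrite /char_poly char_block_diag_mx det_ublock.
Qed.

(** Over polynomials the relation reads [Q (X - B) = (X - A) Q]; in its determinant the unit
    [\det Q] cancels. The equality [m = n] is a premise because [P] will relate a sum of block sizes
    to a dimension. *)
Lemma char_poly_intertwine (F : fieldType) m n (P : 'M[F]_(m, n))
    (A : 'M_m) (B : 'M_n) :
  m = n -> row_free P -> P *m B = A *m P -> char_poly B = char_poly A.
Proof.
move=> eq_mn; case: n / eq_mn P B => P B; rewrite row_free_unit => uP AB.
pose Q := map_mx (@polyC F) P.
have uQ : \det Q \is a GRing.unit.
  by rewrite det_map_mx rmorph_unit // -unitmxE.
have: Q *m char_poly_mx B = char_poly_mx A *m Q.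
  by rewrite /char_poly_mx mulmxBr mulmxBl -!map_mxM AB scalar_mxC.
move/(congr1 determinant); rewrite !det_mulmx [RHS]mulrC.
exact: mulrI.
Qed.

Lemma trigonalizable (C : numClosedFieldType) n (A : 'M[C]_n) :
  exists2 P, P \in unitmx & is_trig_mx (P *m A *m invmx P).
Proof.
(* Schur triangularization asks for a positive size, so the empty matrix is treated apart. *)
case: n A => [|n] A.
  by exists 1%:M; rewrite ?unitmx1 //; apply/is_trig_mxP => -[].
have [//|P /unitarymx_unit uP trigT] := Schur A.
by exists P; rewrite // -conjumx.
Qed.

(** A basis that triangularizes [A] also triangularizes [a + c A], and the diagonal entries [z]
    become [a + c z], with the same multiplicities. *)
Lemma char_poly_affine (C : numClosedFieldType) n (a c : C) (A : 'M[C]_n) :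
  char_poly (a%:M + c *: A) =
    \prod_(z <- eigenvalues A) ('X - (a + c * z)%:P).
Proof.
have [P uP trigT] := trigonalizable A; set T := _ *m _ in trigT.
have PA : P *m A = T *m P by rewrite mulmxKV.
clearbody T.
have fP : row_free P by rewrite row_free_unit.
have eigT : perm_eq (eigenvalues A) [seq T i i | i <- enum 'I_n].
  apply: prod_XsubC_eq; rewrite -char_poly_eigenvalues big_map big_enum /=.
  by rewrite (char_poly_intertwine erefl fP PA) char_poly_trig.
rewrite (perm_big _ eigT) big_map big_enum /=.
rewrite (char_poly_intertwine (A := a%:M + c *: T) erefl fP); last first.
  by rewrite mulmxDr mulmxDl scalar_mxC -scalemxAr PA scalemxAl.
rewrite char_poly_trig; last first.
  apply/is_trig_mxP => i j ij; rewrite !mxE (is_trig_mxP trigT) // mulr0 addr0.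
  by rewrite -val_eqE /= ltn_eqF.
by apply: eq_bigr => i _; rewrite !mxE eqxx.
Qed.

(** Independence and the dimension count make [V] the direct sum of the images of the [T i]; in an
    adapted basis [f] is block diagonal. *)
Lemma char_poly_sum_stable (K : fieldType) (V : vectType K) (f : 'End(V)) m n
    (T : 'I_m -> {linear 'cV[K]_n -> V}) (D : 'I_m -> 'M[K]_n) :
    (forall i v, f (T i v) = T i (D i *m v)) ->
    (forall v, \sum_i T i (v i) = 0 -> forall i, v i = 0) ->
    (m * n)%N = \dim {:V} ->
  char_poly (mxof (vbasis {:V}) (vbasis {:V}) f) =
    \prod_i char_poly (D i).
Proof.
move=> fT freeT dimV.
have bV := vbasisP {:V}.
(* Matrices act on row vectors: the rows of [B i] are the coordinates of the images under [T i] of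
   the standard basis, and the blocks of [f] become the transposes of the [D i]. *)
pose B i := lin1_mx (rVof (vbasis {:V}) \o T i \o trmx).
under eq_bigr do rewrite -char_poly_tr.
rewrite -char_poly_mxdiag.
apply: (char_poly_intertwine (P := \mxcol_i B i)).
- by rewrite sum_nat_const card_ord.
- apply: inj_row_free => u; rewrite -[u]submxrowK mul_mxrow_mxcol => uB0.
  have /eqP : rVof (vbasis {:V}) (\sum_i T i (submxrow u i)^T) = 0.
    by rewrite linear_sum -[RHS]uB0; apply: eq_bigr => i _; rewrite mul_rV_lin1.
  rewrite rVof_eq0 // => /eqP /freeT u0.
  apply: etrans (mxrow0 _); apply/eq_mxrow => i.
  by apply: trmx_inj; rewrite u0 trmx0.
- rewrite mxcol_mul mul_mxdiag_mxcol; apply/eq_mxcol => i.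
  apply/row_matrixP => j; rewrite !rowE !mulmxA !mul_rV_lin1 /=.
  by rewrite rVofK // fT trmx_mul trmxK.
Qed.

Section IrreducibleCharacters.
Variables (C : numClosedFieldType) (gT : finGroupType).
Implicit Type i : irr_index C gT.

(** In characteristic zero Maschke's theorem applies, so the group algebra is semisimple. *)
Let C'G : ([pchar C]^'.-group [set: gT])%g.
Proof. by apply/pgroupP => p _; rewrite inE /= pchar_num. Qed.

(* The central idempotent of the Wedderburn component j is sent to 1 by the
   representation j and to 0 by the others, so it isolates u j. *)
Lemma irr_char_free (u : irr_index C gT -> C) :
  (forall x, \sum_i u i * irr_char i x = 0) -> forall j, u j = 0.
Proof.
move=> u0 j.
have /envelop_mxP[a def_e] : (Wedderburn_id j \in group_ring C [set: gT])%MS.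
  by rewrite -(Wedderburn_sum_pchar (irr_index C gT) C'G) (sumsmx_sup j) // Wedderburn_id_mem.
have op_e i : gring_op (irr_repr i) (Wedderburn_id j) =
    \sum_x a x *: irr_repr i x.
  rewrite def_e linear_sum; apply: eq_big => [x|x _]; first by rewrite inE.
  by rewrite linearZ /= gring_opG ?inE.
have tr_e i : \sum_x a x * irr_char i x =
    \tr (gring_op (irr_repr i) (Wedderburn_id j)).
  by rewrite op_e linear_sum; apply: eq_bigr => x _; rewrite linearZ.
(* The relation between the characters extends linearly from group elements to the idempotent. *)
have : \sum_i u i * \sum_x a x * irr_char i x = 0.
  under eq_bigr do rewrite mulr_sumr.
  rewrite exchange_big big1 // => x _; under eq_bigr do rewrite mulrCA.
  by rewrite -mulr_sumr u0 mulr0.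
rewrite (bigD1 j) //= [X in _ + X]big1 ?addr0 => [/eqP|i neq_ij].
  (* The surviving trace is the degree of the representation, nonzero in characteristic zero. *)
  rewrite tr_e op_Wedderburn_id_pchar // mxtrace1 mulf_eq0.
  by rewrite pnatr_eq0 eqn0Ngt irr_degree_gt0 orbF => /eqP.
by rewrite tr_e (irr_repr'_op0_pchar C'G _ (Wedderburn_id_mem j))
  ?linear0 ?mulr0 // eq_sym.
Qed.

Hypothesis cGG : abelian [set: gT].
Let splitG : group_splitting_field C [set: gT] :=
  @group_closure_closed_field C gT [set: gT]%G.

Lemma card_irr_abelian : #|irr_index C gT| = #|gT|.
Proof.
by rewrite card_irr_pchar // -cardsT; apply/eqP; rewrite -card_classes_abelian.
Qed.

(** Irreducible representations of an abelian group have degree one here, so the trace is the scalar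
    by which an element acts. *)
Lemma irr_charM i : {morph irr_char i : x y / (x * y)%g >-> x * y}.
Proof.
have ZG x : x \in 'Z([set: gT])%g by rewrite (center_idP cGG) inE.
have mode x : irr_char i x = irr_mode i x.
  by rewrite /irr_char irr_center_scalar // mxtrace_scalar irr_degree_abelian.
by move=> x y; rewrite !mode irr_modeM.
Qed.

End IrreducibleCharacters.

Lemma sum_cayley_edge (gT : finGroupType) (S : {mset gT}) (hS : msymmetric S)
    (V : zmodType) (Phi : gT -> gT -> V) (w : gT) :
  \sum_(e : edge (cayley hS) | terminal e == w)
     Phi (initial e) (cayley_label (tag e)) =
  \sum_(s <- S) Phi (w * s^-1)%g s.
Proof.
(* Parallel edges are grouped by their pair of end points; their number is the multiplicity of the
   label. *)
transitivity (\sum_(p : gT * gT | p.2 == w)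
    Phi p.1 (cayley_label p) *+ S (cayley_label p)).
  under [RHS]eq_bigr => p _ do
    rewrite -[S _]card_ord -sum1_card -sumrMnr.
  rewrite sig_big_dep; apply: eq_big => [[p j]|[p j] _] //=.
  by rewrite inE andbT.
rewrite (reindex_onto (fun s : gT => (w * s^-1, w)%g)
                      (fun p => (p.1^-1 * w)%g)) /=; last first.
  by case=> x y /= /eqP ->; rewrite invMg invgK mulKVg.
rewrite big_mset big_uniq /=; last exact: fset_uniq.
rewrite [RHS]big_mkcond /=; apply: eq_big => [s|s _].
  by rewrite eqxx invMg invgK mulgKV eqxx.
rewrite /cayley_label /= invMg invgK mulgKV.
(* Outside the support of [S] the multiplicity takes its default value [0]. *)
by case: ifPn => // /fsfun_dflt ->.
Qed.

Section Twist.
Variables (C : numClosedFieldType) (gT : finGroupType) (N : nat).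
Variable chi : gT -> C.

Definition twist (v : 'cV[C]_N) : {ffun gT -> 'cV[C]_N} :=
  [ffun w => chi (w^-1)%g *: v].

Fact twist_is_linear : linear twist.
Proof.
by move=> a u v; apply/ffunP => w; rewrite !ffunE scalerDr !scalerA mulrC.
Qed.

HB.instance Definition _ :=
  GRing.isLinear.Build C 'cV[C]_N {ffun gT -> 'cV[C]_N} _ twist twist_is_linear.

Lemma laplacian_twist (S : {mset gT}) (hS : msymmetric S)
    (F : gT -> 'M[C]_N) (v : 'cV[C]_N) :
    {morph chi : x y / (x * y)%g >-> x * y} ->
  laplacian (cayley_transmission hS F) (twist v) =
    twist ((1%:M + - (size S)%:R^-1 *: \sum_(s <- S) chi s *: F s) *m v).
Proof.
move=> chiM; apply/ffunP => w; rewrite !ffunE.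
rewrite mulmxDl mul1mx scalerDr -scalemxAl scaleNr scalerN; congr (_ - _).
pose Phi x s := (size S)%:R^-1 *: (F s *m twist v x).
transitivity (\sum_(e : edge (cayley hS) | terminal e == w)
    Phi (initial e) (cayley_label (tag e))).
  (* By regularity the square root is that of the square of [size S]. *)
  apply: eq_bigr => e _; rewrite !cayley_degree.
  by rewrite -expr2 sqrCK ?ler0n.
rewrite sum_cayley_edge mulmx_suml !scaler_sumr; apply: eq_bigr => s _.
(* The inverse of the initial vertex [w s^-1] is [s w^-1], whence the factor [chi s]. *)
rewrite /Phi ffunE invMg invgK chiM -scalemxAr -scalemxAl !scalerA.
by rewrite mulrC [chi s * _]mulrC mulrAC.
Qed.

End Twist.

Lemma laplacian_eigenvalues (C : numClosedFieldType) (gT : finGroupType)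
    (hG : abelian [set: gT]) (S : {mset gT}) (hS : msymmetric S)
    (N : nat) (F : gT -> 'M[C]_N) :
  perm_eq
    (lfun_eigenvalues (linfun (laplacian (cayley_transmission hS F))))
    [seq 1 - (size S)%:R^-1 * l
       | chi <- enum (irr_index C gT),
         l <- eigenvalues (\sum_(s <- S) irr_char chi s *: F s)].
Proof.
pose chi (i : 'I_#|irr_index C gT|) : gT -> C := irr_char (enum_val i).
apply: prod_XsubC_eq; rewrite -char_poly_eigenvalues big_allpairs_dep.
rewrite (char_poly_sum_stable
  (T := fun i => twist (chi i) : {linear 'cV[C]_N -> _})
  (D := fun i => 1%:M + - (size S)%:R^-1 *: \sum_(s <- S) chi i s *: F s)).
- rewrite [RHS]big_enum [RHS]big_enum_val; apply: eq_bigr => i _.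
  by rewrite char_poly_affine; apply: eq_bigr => l _; rewrite mulNr.
- move=> i v; apply: etrans (laplacian_twist hS F v (irr_charM hG _)).
  exact: (lfunE (laplacian (cayley_transmission hS F))).
- move=> v v0 i; apply/colP => a; rewrite mxE -(enum_valK i).
  apply: (@irr_char_free _ _ (fun j => v (enum_rank j) a 0)) => x.
  (* Evaluation at [x^-1] undoes the inverse in [twist], and coordinate [a] gives a scalar relation
     between the characters at [x]. *)
  move/ffunP/(_ (x^-1)%g)/colP/(_ a): v0.
  rewrite ffunE sum_ffunE summxE mxE => v0.
  rewrite -[RHS]v0 [LHS]big_enum_val; apply: eq_bigr => j _.
  by rewrite ffunE mxE enum_valK invgK mulrC.
(* There are as many characters as group elements, and columns have dimension [N * 1]. *)
- by rewrite card_irr_abelian // dimvf -[N in LHS]muln1.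
Qed.

Theorem theorem7 (R : realType) (gT : finGroupType)
    (hG : abelian [set: gT])
    (S : {mset gT}) (k : nat) (hk : size S = k) (hS : msymmetric S)
    (N : nat) (F : gT -> 'M[R[i]]_N)
    (hFunit : forall s : gT, s \in S -> F s \in unitmx)
    (hFinv : forall s : gT, s \in S -> F (s^-1)%g = (F s) ^t*) :
  perm_eq
    (lfun_eigenvalues (linfun (laplacian (cayley_transmission hS F))))
    [seq 1 - k%:R^-1 * l
       | chi <- enum (irr_index R[i] gT),
         l <- eigenvalues (\sum_(s <- S) irr_char chi s *: F s)].
Proof. by rewrite -hk; apply: laplacian_eigenvalues. Qed.
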